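(* A team of $3$ synchronous co-located agents is necessary and sufficient to solve PerpExploration-BBH on a ring $R$ if each node is equipped with a whiteboard having constant memory. That is: (sufficiency) there is a deterministic algorithm for three agents starting at a common safe node, using whiteboards with a constant number of bits at each node, which solves PerpExploration-BBH on every oriented ring; (necessity) no deterministic algorithm for fewer than three such agents does so.
   Context: Model. $R=\{v_0,\dots,v_{n-1}\}$ is a ring with unlabeled nodes; node $v_i$ has two ports, leading to $v_{(i-1)\bmod n}$ and $v_{(i+1)\bmod n}$, consistently labeled left and right. Agents know $n$, have distinct IDs (from $[0,k^c]$, where $k$ is the number of agents and $c$ a constant), have $O(\log n)$ bits of internal memory, and all run the same deterministic algorithm. ''Co-located'' means that all agents start at one common node, called home. Time proceeds in synchronous rounds; in each round every agent at a node $v$ takes a snapshot (the two ports, the content of the whiteboard of $v$, its own memory, the IDs of the agents currently at $v$), then performs a communication step (reading/writing the whiteboard of $v$) and a move step (stay, or move through a port, being at the corresponding neighbour in the next round). Agents crossing the same edge in opposite directions do not notice each other. A whiteboard is a memory at a node which agents at that node can read and modify in mutual exclusion; here each whiteboard has a number of bits that is constant (independent of $n$), and whiteboards are initially blank. Byzantine black hole. Exactly one node $v_b$ is a Byzantine black hole; all other nodes are safe; its position is fixed and unknown to the agents, and may be any node other than the starting node of the agents. At the beginning of each round an adversary (who knows the algorithm) decides whether $v_b$ is active during that round. If active, all agents at $v_b$ in that round are destroyed without trace, and the adversary may additionally choose to erase the information stored at $v_b$. If not active, $v_b$ behaves exactly like a safe node. PerpExploration-BBH: the agents must move so that every node of $R$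 except $v_b$ is visited by at least one agent infinitely often. An algorithm solves the problem if this holds for every ring size $n$, every admissible position of $v_b$ and every behaviour of the adversary. *)

(* Defs.v *)
From mathcomp Require Export all_boot.
Set Implicit Arguments.
Unset Strict Implicit.
Unset Printing Implicit Defensive.

(* IDs of a team of k agents are drawn from [0, k ^ c], both ends included.
   Since IDs are distinct, agents are identified with their IDs below. *)
Definition ID (k c : nat) := 'I_(k ^ c).+1.

Inductive move := Stay | Left | Right.

(* The node reached from v in the oriented ring Z / nZ. *)
Definition dest n (m : move) (v : 'I_n) : 'I_n :=
  match m with
  | Stay => v
  | Left => ord_pred v
  | Right => ordS v
  end.

(* A deterministic algorithm, common to k agents with IDs in [0, k ^ c].
   All agents know the ring size n, hence the argument n of mem, init and act;
   node names are never shown to an agent.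
   - mem n is the set of states of an agent's internal memory on the ring of
     size n: O(log n) bits, i.e. 2 ^ O(log n) states.
   - board is the set of contents of one whiteboard: a finite set that does not
     depend on n, i.e. a constant number of bits.
   - act n i S w0 x w is the behaviour in one round of the agent of ID i whose
     snapshot consists of the set S of IDs at its node, the whiteboard content
     w0 at the beginning of the round and its own memory x, and which finds w on
     the whiteboard when it is granted exclusive access to it: the new memory,
     the content left on the whiteboard, and the move. *)
Record algorithm (k c : nat) := Algorithm {
  mem : nat -> finType;
  mem_log : exists C, forall n, 1 < n -> #|mem n| <= 2 ^ (C * trunc_log 2 n);
  board : finType;
  blank : board;
  init : forall n, mem n;
  act : forall n, ID k c -> {set ID k c} -> board -> mem n -> board ->
          mem n * board * move
}.

(* The order in which co-located agents are granted access to the whiteboard: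
   in round t the agents at a node go in the order `sort (ord t)` puts them.
   `sort` permutes its argument whatever the relation is, so ord needs no
   hypothesis, and every sequence of orders on the IDs is obtained. *)
Definition access_order (k c : nat) := nat -> rel (ID k c).

(* Behaviour of the adversary round by round; erase t only matters when
   active t holds.  Algorithms being deterministic, an adversary who knows the
   algorithm amounts to an arbitrary such sequence. *)
Record adversary := Adversary {
  active : nat -> bool;
  erase : nat -> bool
}.

Section Execution.

Variables (k c : nat) (A : algorithm k c) (n : nat).

(* agents i = None when no agent has ID i or that agent has been destroyed. *)
Record config := Config {
  agents : ID k c -> option ('I_n * mem A n);
  boards : 'I_n -> board A
}.

Definition is_at (s : config) (v : 'I_n) (i : ID k c) : bool :=
  if agents s i is Some p then p.1 == v else false.

Definition present (s : config) (v : 'I_n) : {set ID k c} :=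
  [set i | is_at s v i].

Definition start (D : {set ID k c}) (home : 'I_n) : config :=
  Config (fun i => if i \in D then Some (home, init A n) else None)
         (fun _ => blank A).

Definition black_hole (b : 'I_n) (act_t erase_t : bool) (s : config) : config :=
  if act_t then
    Config (fun i => if is_at s b i then None else agents s i)
           (fun v => if (v == b) && erase_t then blank A else boards s v)
  else s.

Definition response (s : config) (v : 'I_n) (i : ID k c) (x : mem A n)
    (w : board A) : mem A n * board A * move :=
  act i (present s v) (boards s v) x w.

Definition write (s : config) (v : 'I_n) (w : board A) (i : ID k c) : board A :=
  if agents s i is Some p then (response s v i p.2 w).1.2 else w.

Definition queue (ord_t : rel (ID k c)) (s : config) (v : 'I_n) :
    seq (ID k c) :=
  sort ord_t (enum (present s v)).

(* Whiteboard of v once the agents of the list q have accessed it in turn. *)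
Definition board_after (s : config) (v : 'I_n) (q : seq (ID k c)) : board A :=
  foldl (write s v) (boards s v) q.

Definition board_found_by (ord_t : rel (ID k c)) (s : config) (v : 'I_n)
    (i : ID k c) : board A :=
  let q := queue ord_t s v in board_after s v (take (index i q) q).

Definition agents_act (ord_t : rel (ID k c)) (s : config) : config :=
  Config
    (fun i =>
       if agents s i is Some (v, x) then
         let: (x', _, m) := response s v i x (board_found_by ord_t s v i) in
         Some (dest m v, x')
       else None)
    (fun v => board_after s v (queue ord_t s v)).

Fixpoint run (ord : access_order k c) (adv : adversary) (b : 'I_n)
    (s0 : config) (t : nat) : config :=
  if t is t'.+1 then
    agents_act (ord t')
      (black_hole b (active adv t') (erase adv t') (run ord adv b s0 t'))
  else s0.

Definition visited (s : config) (v : 'I_n) : Prop := exists i, is_at s v i.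

End Execution.

Definition perpetual_exploration n k c (A : algorithm k c) (b : 'I_n)
    (e : nat -> config A n) : Prop :=
  forall v : 'I_n, v != b -> forall T, exists2 t, T <= t & visited (e t) v.

(* D is the set of IDs of the agents, all of which start at home.  The sizes
   n <= 1 are vacuous because b != home. *)
Definition solves_PerpExploration_BBH k c (ord : access_order k c)
    (A : algorithm k c) : Prop :=
  forall (n : nat) (home b : 'I_n) (D : {set ID k c}) (adv : adversary),
    b != home -> #|D| = k ->
    perpetual_exploration b (run ord adv b (start A D home)).

(* Main.v *)
(* With fewer than three agents, look at the fault-free run on a ring of size 4
   when some agent X first steps from a neighbour u of home onto the node u'
   opposite home. The hole may be u, active from the last round X spends there,
   or u', active from the arrival of X on. The other agent, if any, sees the same
   in both scenarios until it enters u or u': it would die in one of them, and if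
   it never enters either then it fails to explore.

   With three agents, the scout x walks around the ring forever, writing the
   parity of its lap on every sheet, while y and z wait at home. If x is missing
   at the end of a lap, the hole is the first node without the parity of that
   lap. Then y walks to the right, and whenever it finds the parity of that lap on
   a new node it goes back one step to write there that the next node is safe.
   It never leaves the hole if it gets there. After 3 n rounds z walks to the
   right as long as the next node is declared safe; it then knows the position of
   the hole and walks back and forth between its two neighbours. *)
From HB Require Import structures.
Require Import Defs.
From mathcomp Require Import all_boot zify.
Set Implicit Arguments.
Unset Strict Implicit.
Unset Printing Implicit Defensive.

(** * Fewer than three agents *)

Section Necessity.

Variables (k c n : nat) (A : algorithm k c) (ord : access_order k c).
Implicit Types (s : config A n) (u v b : 'I_n) (i j : ID k c).

Lemma agents_actE r s i :
  agents (agents_act r s) i =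
  if agents s i is Some p then
    let y := response s p.1 i p.2 (board_found_by r s p.1 i) in
    Some (dest y.2 p.1, y.1.1)
  else None.
Proof.
by rewrite /=; case: (agents s i) => [[v x]|] //=; case: response => [[]].
Qed.

Lemma agents_act_None r s i : agents s i = None -> agents (agents_act r s) i = None.
Proof. by rewrite agents_actE => ->. Qed.

(** * Holes that stay active once they wake, and extinction of the team *)

Definition active_from t0 := Adversary (leq t0) xpred0.

(** An inactive hole behaves like a safe node, so its position has had no effect yet. *)
Lemma run_active_from b b' s t0 t : t <= t0 ->
  run ord (active_from t0) b s t = run ord (Adversary xpred0 xpred0) b' s t.
Proof.
by elim: t => //= t IHt lt_t; rewrite /black_hole leqNgt lt_t IHt // ltnW.
Qed.

Lemma run_alive adv b D (home : 'I_n) t i :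
  agents (run ord adv b (start A D home) t) i -> i \in D.
Proof.
elim: t => [|t IHt] /=; first by case: (i \in D).
set r := run _ _ _ _ _ in IHt *; move=> al; apply: IHt; move: al.
case: (active adv t) => /=; last by case: (agents r i) => [[]|].
by case: (is_at r b i) => //; case: (agents r i) => [[]|].
Qed.

Lemma agents_hole b s i :
  agents (black_hole b true false s) i = if is_at s b i then None else agents s i.
Proof. by []. Qed.

Lemma boards_hole b s v : boards (black_hole b true false s) v = boards s v.
Proof. by rewrite /= andbF. Qed.

Definition extinct s := forall i, agents s i = None.

Lemma extinct_hole b a e s : extinct s -> extinct (black_hole b a e s).
Proof.
by move=> ds i; rewrite /black_hole; case: a => //=; rewrite ds; case: is_at.
Qed.

Lemma extinct_act r s : extinct s -> extinct (agents_act r s).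
Proof. by move=> ds i; apply: agents_act_None. Qed.

Lemma extinct_unvisited adv b s t0 : 
  extinct (black_hole b (active adv t0) (erase adv t0) (run ord adv b s t0)) ->
  forall t, t0 < t -> forall v, ~ visited (run ord adv b s t) v.
Proof.
move=> ex t /subnKC <-; move: (t - _) => d v [i].
suff: extinct (run ord adv b s (t0.+1 + d)).
  by move=> ds; rewrite /is_at ds.
elim: d => [|d IHd]; first by rewrite addn0; apply: extinct_act.
by rewrite addnS; apply: extinct_act; apply: extinct_hole.
Qed.

(* Agents other than x see the same thing in s1 and s2 as long as they stay away from F. *)
Record alike (F : pred 'I_n) (x : ID k c) s1 s2 : Prop := Alike {
  alike_agents : forall i, i != x -> agents s1 i = agents s2 i;
  alike_boards : forall v, v \notin F -> boards s1 v = boards s2 v }.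

(** The agent [x], if alive, is inside [F], so the nodes outside [F] show the same IDs and the same
    whiteboards in both configurations. The other agents are all there, hence act identically, and
    they alone write there. *)
Lemma alike_act r F x s1 s2 : alike F x s1 s2 ->
  (forall i p, i != x -> agents s1 i = Some p -> p.1 \notin F) ->
  (forall p, agents s1 x = Some p -> p.1 \in F) ->
  (forall p, agents s2 x = Some p -> p.1 \in F) ->
  alike F x (agents_act r s1) (agents_act r s2).
Proof.
case=> eqa eqb offF x1 x2.
have is_atE v i : v \notin F -> is_at s1 v i = is_at s2 v i.
  move=> vF; rewrite /is_at; have [->|/eqa-> //] := eqVneq i x.
  have NF w : w \in F -> (w == v) = false.
    by move=> pF; apply/eqP => eqv; rewrite eqv (negPf vF) in pF.
  case E1: (agents s1 x) => [p|]; case E2: (agents s2 x) => [q|] //.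
  - by rewrite (NF _ (x1 _ E1)) (NF _ (x2 _ E2)).
  - by rewrite (NF _ (x1 _ E1)).
  - by rewrite (NF _ (x2 _ E2)).
have presE v : v \notin F -> present s1 v = present s2 v.
  by move=> vF; apply/setP => i; rewrite !inE is_atE.
have afterE v q : v \notin F -> {subset q <= present s1 v} ->
    board_after s1 v q = board_after s2 v q.
  move=> vF; rewrite /board_after eqb //; elim: q (boards s2 v) => //= i q IHq w sub.
  have iv : i \in present s1 v by apply: sub; rewrite mem_head.
  have ix : agents s1 i = agents s2 i.
    have [eix|/eqa //] := eqVneq i x.
    move: iv; rewrite inE /is_at eix; case E1: (agents s1 x) => [p|] // /eqP pv.
    by rewrite -pv (x1 _ E1) in vF.
  have ->: write s1 v w i = write s2 v w i.
    by rewrite /write ix /response presE ?eqb.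
  by apply: IHq => j jq; apply: sub; rewrite inE jq orbT.
have sub_queue v : {subset queue r s1 v <= present s1 v}.
  by move=> i; rewrite mem_sort mem_enum.
split=> [i ix|v vF] /=; last first.
  by rewrite (afterE v _ vF (sub_queue v)) /queue presE.
case E: (agents s1 i) => [[v y]|]; rewrite -eqa ?E //.
have /= vF := offF _ _ ix E.
rewrite /response /board_found_by (afterE v _ vF).
  by rewrite /queue presE // eqb.
by move=> j /mem_take; apply: sub_queue.
Qed.

(** In [r1] the agent [x] is lost at [u] in round [t]; in [r2] it is lost at [u'] one round later.
    [h1] and [h2] are the configurations just after the hole has acted, and [F] is where the
    whiteboards of the two scenarios may differ. *)
Lemma two_scenarios (D : {set ID k c}) (home u u' : 'I_n) b0 x y t :
  #|D| <= 2 -> u != u' ->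
  (forall t0 b, b \in [:: u; u'] ->
     perpetual_exploration b (run ord (active_from t0) b (start A D home))) ->
  let e := run ord (Adversary xpred0 xpred0) b0 (start A D home) in
  agents (e t) x = Some (u, y) -> is_at (e t.+1) u' x -> False.
Proof.
move=> card_D uu' sol e xu xu'.
pose F := pred2 u u'.
pose r1 := run ord (active_from t) u (start A D home).
pose r2 := run ord (active_from t.+1) u' (start A D home).
pose h1 m := black_hole u true false (r1 m).
pose h2 m := black_hole u' true false (r2 m).
have alive1 : ~ exists2 m, t <= m & extinct (h1 m).
  case=> m ts ex; have /(_ u' _ m.+1) := sol t u (mem_head _ _).
  rewrite eq_sym => /(_ uu') [m' ss']; apply: extinct_unvisited ss' _ => /=.
  by rewrite ts.
have alive2 : ~ exists2 m, t < m & extinct (h2 m).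
  case=> m ts ex; have u'in : u' \in [:: u; u'] by rewrite !inE eqxx orbT.
  have [m' ss'] := sol t.+1 u' u'in u uu' m.+1.
  by apply: extinct_unvisited ss' _ => /=; rewrite ts.
have aliveD adv b m i p :
    agents (run ord adv b (start A D home) m) i = Some p -> i \in D.
  by move=> E; apply: (@run_alive adv b D home m); rewrite E.
have xD := aliveD _ _ _ _ _ xu.
have other i j : i \in D -> j \in D -> i != x -> j != x -> i = j.
  move=> iD jD ix jx; apply/eqP; apply: contraLR card_D => ij; rewrite -ltnNge.
  apply: (@leq_trans #|[set x; i; j]|); last first.
    by apply/subset_leq_card/subsetP => l; rewrite !inE => /orP[/orP[]|] /eqP->.
  by rewrite -setUA cardsU1 cards2 !inE ij eq_sym (negPf ix) eq_sym (negPf jx).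
have lonely b m adv i p : i != x -> let r := run ord adv b (start A D home) in
   (forall q, agents (r m) x = Some q -> q.1 = b) ->
    agents (r m) i = Some p -> p.1 = b -> extinct (black_hole b true false (r m)).
  move=> ix r xb Ei pb j; rewrite agents_hole.
  case Ej: (agents (r m) j) => [q|]; last by case: is_at.
  rewrite /is_at Ej; have [ejx|jx] := eqVneq j x.
    by rewrite (xb q) ?eqxx // -ejx.
  have eij : j = i by apply: other jx ix; [exact: aliveD Ej|exact: aliveD Ei].
  by move: Ej; rewrite eij Ei => -[<-]; rewrite pb eqxx.
have u_bh b m adv i p :
  agents (black_hole b true false (run ord adv b (start A D home) m)) i = Some p ->
  p.1 != b.
  rewrite agents_hole /is_at; case: (agents _ i) => [q|] //.
  by case: eqP => // /eqP qb [<-].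
have bhE b m adv i p :
  agents (black_hole b true false (run ord adv b (start A D home) m)) i = Some p ->
  agents (run ord adv b (start A D home) m) i = Some p.
  by rewrite agents_hole; case: is_at.
have r1S m : t <= m -> r1 m.+1 = agents_act (ord m) (h1 m).
  by move=> ts; rewrite /r1 /= ts.
have r2S m : t < m -> r2 m.+1 = agents_act (ord m) (h2 m).
  by move=> ts; rewrite /r2 /= ts.
(* The other agent is on neither node of [F]: on [u] it would be lost in the first scenario, and on
   [u'] in the second, where it has the same position. Either way nobody would be left. *)
have after m : t <= m ->
    alike F x (r1 m.+1) (r2 m.+1) -> agents (r1 m.+1) x = None ->
    (forall q, agents (r2 m.+1) x = Some q -> q.1 = u') ->
  [/\ alike F x (h1 m.+1) (h2 m.+1),
      agents (h1 m.+1) x = None, agents (h2 m.+1) x = None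
   & (forall i p, i != x -> agents (h1 m.+1) i = Some p -> p.1 \notin F)].
  move=> ts [eqa eqb] x1 x2.
  have off i p : i != x -> agents (r1 m.+1) i = Some p -> p.1 \notin F.
    move=> ix Ei; rewrite !inE; apply/norP; split; apply/eqP => pu.
      apply: alive1; exists m.+1; first exact: ltnW.
      by apply: lonely pu; eauto; rewrite x1.
    apply: alive2; exists m.+1 => //; apply: lonely pu; eauto.
    by rewrite -eqa.
  have offE i p : i != x -> agents (h1 m.+1) i = Some p -> p.1 \notin F.
    by move=> ix /bhE; apply: off.
  split=> //; first split=> [i ix|v vF].
  - rewrite !agents_hole /is_at -eqa //; case E: (agents (r1 m.+1) i) => [p|] //.
    by have := off _ _ ix E; rewrite !inE => /norP[/negPf-> /negPf->].
  - by rewrite !boards_hole eqb.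
  - by rewrite agents_hole x1; case: is_at.
  - case E: (agents (h2 m.+1) x) => [p|] //.
    by have := u_bh _ _ _ _ _ E; rewrite (x2 p) ?eqxx //; exact: bhE E.
have r1t : r1 t = e t by apply: run_active_from.
have r2t : r2 t = e t by apply: run_active_from.
have r2t1 : r2 t.+1 = e t.+1 by apply: run_active_from.
have e_S : e t.+1 = agents_act (ord t) (e t) by [].
have h1x : agents (h1 t) x = None by rewrite agents_hole r1t /is_at xu eqxx.
have base :
  [/\ alike F x (h1 t.+1) (h2 t.+1),
      agents (h1 t.+1) x = None, agents (h2 t.+1) x = None
   & (forall i p, i != x -> agents (h1 t.+1) i = Some p -> p.1 \notin F)].
  have off i p : i != x -> agents (e t) i = Some p -> p.1 != u.
    move=> ix Ei; apply/eqP => pu; apply: alive1; exists t => //.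
    rewrite -r1t in Ei; apply: (lonely _ _ _ _ _ ix _ Ei pu) => q.
    by rewrite -/r1 r1t xu => -[<-].
  (* In round [t] only the first hole is active, and the second scenario still coincides with [e].
     Since [x] is still at [u] there, the comparison starts with the smaller region [pred1 u]. *)
  have al : alike (pred1 u) x (h1 t) (e t).
    split=> [i ix|v vF]; last by rewrite boards_hole r1t.
    rewrite agents_hole r1t /is_at; case E: (agents (e t) i) => [p|] //.
    by rewrite (negPf (off _ _ ix E)).
  apply: after => //.
  - rewrite r1S // r2t1 e_S.
    case: (alike_act (ord t) al) => [i p ix /bhE|p|p|eqa eqb].
    + by rewrite -[run _ _ _ _ _]/(r1 t) r1t; apply: off.
    + by rewrite h1x.
    + by rewrite xu => -[<-]; rewrite inE.
    by split=> // v; rewrite inE negb_or => /andP[vu _]; apply: eqb.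
  - by rewrite r1S //; apply: agents_act_None.
  - by move=> q; rewrite r2t1 => E; move: xu'; rewrite /is_at E => /eqP.
have main m : t < m ->
   [/\ alike F x (h1 m) (h2 m), agents (h1 m) x = None, agents (h2 m) x = None
   & (forall i p, i != x -> agents (h1 m) i = Some p -> p.1 \notin F)].
  elim: m => // m IHs; rewrite ltnS leq_eqVlt => /orP[/eqP<- //|ts].
  have [al x1 x2 off] := IHs ts; apply: after; first exact: ltnW.
  - rewrite r1S 1?ltnW // r2S //; apply: alike_act => //; by [rewrite x1|rewrite x2].
  - by rewrite r1S 1?ltnW //; apply: agents_act_None.
  - by rewrite r2S // agents_act_None.
(* With the hole at [u], the node [u'] must be visited again; [x] is dead and the other agent never
   goes there. *)
have [m ts [i]] := sol t u (mem_head _ _) u' (contra_neq (@esym _ _ _) uu') t.+1.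
have [_ x1 _ off] := main m ts.
rewrite /is_at -/r1; case E: (agents (r1 m) i) => [p|] // /eqP pu'.
have E1 : agents (h1 m) i = Some p.
  by rewrite agents_hole /is_at E pu' eq_sym (negPf uu').
have [ix|/off/(_ E1)] := eqVneq i x; first by rewrite ix x1 in E1.
by rewrite !inE pu' eqxx orbT.
Qed.

End Necessity.

(** On a ring of size 4 the node [u'] opposite [home] is not adjacent to it. Hence the node [u] from
    which [u'] is first entered is not [home], and both [u] and [u'] are admissible positions of the
    hole. *)
Lemma two_agents_fail k c (ord : access_order k c) (A : algorithm k c) :
  k < 3 -> ~ solves_PerpExploration_BBH ord A.
Proof.
move=> k_lt3 sol.
have [D cardD] : exists D : {set ID k c}, #|D| = k.
  (* There are enough IDs, since [k <= k ^ c + 1] for [k < 3], even if [c = 0]. *)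
  exists [set i in take k (enum 'I_(k ^ c).+1)].
  rewrite cardsE (card_uniqP _) ?take_uniq ?enum_uniq // size_takel // size_enum_ord.
  case: k k_lt3 {ord A sol} => [|[|[|]]] //= _; by rewrite ?ltnS ?expn_gt0.
pose home : 'I_4 := ord0; pose b0 : 'I_4 := Ordinal (isT : 1 < 4).
pose u' : 'I_4 := Ordinal (isT : 2 < 4).
pose e := run ord (Adversary xpred0 xpred0) b0 (start A D home).
have ex : exists t, [exists i, is_at (e t) u' i].
  have [t _ [i]] := sol 4 home b0 D (Adversary xpred0 xpred0) isT cardD u' isT 0.
  by exists t; apply/existsP; exists i.
case: (ex_minnP ex) => -[|t] /existsP[x xu'] min_t.
  by move: xu'; rewrite /is_at /=; case: (x \in D).
case xt : (agents (e t) x) => [[u y]|]; last first.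
  by move: xu'; rewrite /is_at [e _]/(agents_act _ (e t)) agents_act_None.
have uu' : u != u'.
  apply/negP => uu'; suff: t.+1 <= t by rewrite ltnn.
  by apply: min_t; apply/existsP; exists x; rewrite /is_at xt.
have uh : u != home.
  apply: contraL xu' => /eqP uh.
  rewrite /is_at [e _]/(agents_act (ord t) (e t)) agents_actE xt uh /=.
  by case: (response _ _ _ _ _) => [[? ?] []].
apply: (two_scenarios _ uu' _ xt xu'); first by rewrite cardD.
move=> t0 b; rewrite !inE => bu; apply: sol cardD.
by case/orP: bu => /eqP->.
Qed.

(** * Three agents *)

(** After [Start], agent [x] is [Scout] forever; [y] goes from [Wait false] to the cycle [Probe],
    [Check], [Confirm]; [z] goes from [Wait true] through [Delay] and [Follow] to [Patrol]. The
    argument of the phases of [y] after waiting is the parity of the lap in which [x] was lost. *)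
Inductive phase :=
  | Start | Scout | Wait of bool | Probe of bool | Check of bool
  | Confirm of bool | Delay | Follow | Patrol.

Definition phase_code (f : phase) : 'I_9 * bool :=
  match f with
  | Start => (inord 0, false)
  | Scout => (inord 1, false)
  | Wait z => (inord 2, z)
  | Probe p => (inord 3, p)
  | Check p => (inord 4, p)
  | Confirm p => (inord 5, p)
  | Delay => (inord 6, false)
  | Follow => (inord 7, false)
  | Patrol => (inord 8, false)
  end.

Definition phase_decode (a : 'I_9 * bool) : phase :=
  nth Start [:: Start; Scout; Wait a.2; Probe a.2; Check a.2; Confirm a.2;
                Delay; Follow; Patrol] a.1.

Lemma phase_codeK : cancel phase_code phase_decode.
Proof. by rewrite /phase_decode; case=> [||?|?|?|?|||] /=; rewrite inordK. Qed.

HB.instance Definition _ := Finite.copy phase (can_type phase_codeK).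

(** The counter runs modulo [2 * n] in the laps and in the patrol, and up to [3 * n] in [Delay]. *)
Definition state n : finType := (phase * 'I_(3 * n).+1)%type.

(* First component: parity of the last lap in which the scout came by.
   Second component: the next node on the right has been confirmed safe. *)
Definition sheet : finType := (option bool * bool)%type.

Section Algorithm.

Variable c : nat.

(** In the first round each agent sees all three IDs, so roles can be given by rank. *)
Definition initial_phase (i : ID 3 c) (S : {set ID 3 c}) : phase :=
  nth (Wait true) [:: Scout; Wait false] (index i (enum S)).

(** In [Wait], the scout is due when [n] divides the counter. In [Patrol], a period of [2 * n]
    rounds consists of [n - 2] steps left, two rounds of rest, [n - 2] steps right and two rounds of
    rest. *)
Definition decide n (i : ID 3 c) (S : {set ID 3 c}) (w : sheet) (x : state n) :
    state n * move :=
  let q : nat := x.2 in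
  match x.1 with
  | Start => ((initial_phase i S, ord0), Stay)
  | Scout => ((Scout, inord (q.+1 %% (2 * n))), Right)
  | Wait z =>
      if (n %| q) && (#|S| < 3) then
        ((if z then Delay else Probe (q == 0), ord0), Stay)
      else ((Wait z, inord (q.+1 %% (2 * n))), Stay)
  | Probe p => ((Check p, ord0), Right)
  | Check p =>
      if w.1 == Some p then ((Confirm p, ord0), Left) else ((Check p, ord0), Stay)
  | Confirm p => ((Probe p, ord0), Right)
  | Delay =>
      ((if q == 3 * n then (Follow, ord0) else (Delay, inord q.+1)), Stay)
  | Follow => if w.2 then (x, Right) else ((Patrol, ord0), Stay)
  | Patrol =>
      ((Patrol, inord (q.+1 %% (2 * n))),
       if q.+2 < n then Left else if n <= q < (2 * n).-2 then Right else Stay)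
  end.

Definition update n (x : state n) (w : sheet) : sheet :=
  match x.1 with
  | Scout => (Some (n <= x.2), w.2)
  | Confirm _ => (w.1, true)
  | _ => w
  end.

Lemma state_log : exists C, forall n, 1 < n -> #|state n| <= 2 ^ (C * trunc_log 2 n).
Proof.
(* With [l = trunc_log 2 n], there are at most [18 * (3 * n + 1) <= 2 ^ (l + 9)] states, and
   [l + 9 <= 12 * l] because [l >= 1]. *)
exists 12 => n n_gt1.
have n_lt : n < 2 ^ (trunc_log 2 n).+1 by apply: trunc_log_ltn.
have l_gt0 : 0 < trunc_log 2 n by rewrite trunc_log_gt0.
have card_phase := leq_card _ (can_inj phase_codeK).
rewrite card_prod card_ord (leq_trans (leq_mul card_phase (leqnn _))) //.
rewrite card_prod card_ord card_bool.
apply: (@leq_trans (2 ^ (8 + (trunc_log 2 n).+1))).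
  rewrite expnD (_ : 2 ^ 8 = 256) //; lia.
by rewrite leq_exp2l //; lia.
Qed.

Definition cautious_team : algorithm 3 c :=
  @Algorithm 3 c state state_log sheet (None, false) (fun n => (Start, ord0))
    (fun n i S w0 x w => let: (x', m) := decide i S w0 x in (x', update x w, m)).

(** * Effect of one round on agents and whiteboards *)

Variables (n : nat) (ord : access_order 3 c).
Local Notation A := cautious_team.
Implicit Types (s : config A n) (v : 'I_n) (i : ID 3 c).

Definition advance s i (o : option ('I_n * state n)) : option ('I_n * state n) :=
  if o is Some (v, x) then
    let: (x', m) := decide i (present s v) (boards s v) x in Some (dest m v, x')
  else None.

(** Decisions use the whiteboard as it was at the beginning of the round, so the access order does
    not influence them. *)
Lemma agents_advance r s i : agents (agents_act r s) i = advance s i (agents s i).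
Proof.
rewrite /= /advance; case: (agents s i) => [[v x]|] //.
by rewrite /response /=; case: decide.
Qed.

Arguments advance : simpl never.

Definition inked (o : option ('I_n * state n)) v (w : sheet) : sheet :=
  if o is Some (u, x) then if u == v then update x w else w else w.

(** With a single writer the access order does not influence the whiteboards either. *)
Lemma boards_inked r s j v :
  (forall i p, i != j -> agents s i = Some p -> update p.2 =1 id) ->
  boards (agents_act r s) v = inked (agents s j) v (boards s v).
Proof.
move=> idle; rewrite /= /board_after.
have writeE w i : write s v w i =
    if i == j then if agents s j is Some p then update p.2 w else w else w.
  rewrite /write /response /=; have [->|ij] := eqVneq i j.
    by case: (agents s j) => [p|] //; case: decide.
  case E: (agents s i) => [p|] //; case: decide => _ _ /=.
  by rewrite (idle _ _ ij E).
have quE i : (i \in queue r s v) = is_at s v i by rewrite mem_sort mem_enum inE.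
have: uniq (queue r s v) by rewrite sort_uniq enum_uniq.
have -> : inked (agents s j) v (boards s v) =
    if j \in queue r s v then
      if agents s j is Some p then update p.2 (boards s v) else boards s v
    else boards s v.
  by rewrite quE /is_at /inked; case: (agents s j) => [[u x]|].
elim: (queue r s v) (boards s v) => //= i q IHq w /andP[iq uq].
rewrite writeE IHq // inE [j == i]eq_sym; have [<-|_] //= := eqVneq i j.
by rewrite (negPf iq).
Qed.

(** * Positions counted to the right from home, and configurations of the three agents *)

Variables (home : 'I_n) (x y z : ID 3 c) (beta : nat).
Hypotheses (xy : x != y) (xz : x != z) (yz : y != z).
Hypotheses (beta_gt0 : 0 < beta) (beta_lt : beta < n).

Definition pos d : 'I_n := iter d (@ordS n) home.
Arguments pos : simpl never.
Local Notation b := (pos beta).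

Lemma val_pos d : val (pos d) = (home + d) %% n.
Proof.
elim: d => [|d IHd]; first by rewrite addn0 modn_small.
by rewrite /= [nat_of_ord (pos d)]IHd -addn1 modnDml -addnA addn1.
Qed.

Lemma eq_pos d e : (pos d == pos e) = (d == e %[mod n]).
Proof.
by rewrite -val_eqE /= [nat_of_ord _]val_pos [X in _ == X]val_pos eqn_modDl.
Qed.

Lemma eq_pos_small d e : d < n -> e < n -> (pos d == pos e) = (d == e).
Proof. by move=> dn en; rewrite eq_pos !modn_small. Qed.

Lemma pos_surj v : exists2 d, d < n & v = pos d.
Proof.
exists ((v + (n - home)) %% n); first by rewrite ltn_mod; case: n v => [[]|].
apply: val_inj; rewrite val_pos modnDmr addnCA subnKC 1?ltnW //.
by rewrite modnDr modn_small.
Qed.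

Lemma pos_n : pos n = pos 0.
Proof. by apply/eqP; rewrite eq_pos modnn mod0n. Qed.

Definition team s ox oy oz := forall i,
  agents s i =
    if i == x then ox else if i == y then oy else if i == z then oz else None.

Definition kill (a : bool) (o : option ('I_n * state n)) :=
  if o is Some p then if a && (p.1 == b) then None else Some p else None.

Lemma team_step r a e s ox oy oz : team s ox oy oz ->
  let s' := black_hole b a e s in
  [/\ team s' (kill a ox) (kill a oy) (kill a oz)
    & team (agents_act r s') (advance s' x (kill a ox)) (advance s' y (kill a oy))
        (advance s' z (kill a oz))].
Proof.
move=> ts s'; have ts' : team s' (kill a ox) (kill a oy) (kill a oz).
  move=> i; transitivity (kill a (agents s i)).
    by rewrite /s' /black_hole /kill; case: (a) => /=; rewrite /is_at; case: agents.
  by rewrite ts; do 3?case: eqP => // _.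
split=> // i; rewrite agents_advance ts'; do 3?[case: eqP => [->|_] //].
Qed.

Definition idle (o : option ('I_n * state n)) :=
  forall p, o = Some p -> update p.2 =1 id.

Lemma idle_Some v f q :
  (if f is Scout then false else if f is Confirm _ then false else true) ->
  idle (Some (v, (f, q))).
Proof. by move=> nf _ [<-] w /=; rewrite /update; case: f nf. Qed.

Lemma idle_kill a o : idle o -> idle (kill a o).
Proof.
move=> io p; rewrite /kill; case: o io => // p' io; case: ifP => // _ [<-].
exact: io.
Qed.

Lemma boards_x r s ox oy oz v : team s ox oy oz -> idle oy -> idle oz ->
  boards (agents_act r s) v = inked ox v (boards s v).
Proof.
move=> ts iy iz; rewrite (@boards_inked _ s x) ?ts ?eqxx // => i p /negPf ix.
by rewrite ts ix; case: ifP => _; [apply: iy|case: ifP => _ //; apply: iz].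
Qed.

Lemma boards_y r s oy oz v : team s None oy oz -> idle oz ->
  boards (agents_act r s) v = inked oy v (boards s v).
Proof.
move=> ts iz; rewrite (@boards_inked _ s y) ?ts ?eqxx ?[y == x]eq_sym ?(negPf xy) //.
by move=> i p /negPf iy; rewrite ts iy; do 2![case: ifP => // _]; apply: iz.
Qed.

Definition at_home (o : option ('I_n * state n)) : bool :=
  if o is Some p then p.1 == home else false.

Lemma card_present s ox oy oz : team s ox oy oz ->
  #|present s home| = at_home ox + at_home oy + at_home oz.
Proof.
move=> ts.
rewrite (cardsD1 x) (cardsD1 y) (cardsD1 z) !inE.
rewrite (_ : _ :\ z = set0) ?cards0; last first.
  apply/setP => i; rewrite !inE /is_at ts.
  have [->|_] := eqVneq i x; first by rewrite !andbF.
  have [->|_] := eqVneq i y; first by rewrite !andbF.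
  by case: eqVneq.
rewrite /is_at !ts !eqxx ![_ == x]eq_sym ![z == y]eq_sym.
rewrite (negPf xy) (negPf xz) (negPf yz) /= addn0.
by rewrite addnA.
Qed.

Lemma board_hole a e s v : v != b -> boards (black_hole b a e s) v = boards s v.
Proof. by move=> vb; rewrite /black_hole; case: a => //=; rewrite (negPf vb). Qed.

(** Erasing leaves [None]: the adversary can remove a parity mark but cannot forge one. *)
Lemma mark_hole a e s p : (boards s b).1 != Some p ->
  (boards (black_hole b a e s) b).1 != Some p.
Proof. by move=> mb; rewrite /black_hole; case: a => //=; rewrite eqxx; case: e. Qed.

Lemma before_hole d : d < beta -> pos d != b.
Proof. by move=> db; rewrite eq_pos_small ?(ltn_trans db) // ltn_eqF. Qed.

Lemma home_hole : home != b.
Proof. by have := before_hole beta_gt0. Qed.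

Lemma kill_home a q : kill a (Some (home, q)) = Some (home, q).
Proof. by rewrite /kill (negPf home_hole) andbF. Qed.

(** * The laps of the scout *)

Definition clock (j : bool) r := (j * n + r) %% (2 * n).

Lemma clock_lt (j : bool) r : clock j r < (3 * n).+1.
Proof. by rewrite ltnS ltnW // (@leq_trans (2 * n)) ?ltn_mod ?leq_mul2r; lia. Qed.

Lemma clockS (j : bool) r : (clock j r).+1 %% (2 * n) = clock j r.+1.
Proof. by rewrite /clock -addn1 modnDml -addnA addn1. Qed.

Lemma clock_n (j : bool) : clock j n = clock (~~ j) 0.
Proof.
rewrite /clock; case: j => /=; last by rewrite mul0n mul1n addn0.
by rewrite mul1n addnn -mul2n modnn mod0n.
Qed.

Lemma clock_small (j : bool) r : r < n -> clock j r = j * n + r.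
Proof. by move=> rn; rewrite /clock modn_small //; case: j => /=; lia. Qed.

Lemma dvd_clock (j : bool) r : r < n -> (n %| clock j r) = (r == 0).
Proof.
move=> rn; rewrite clock_small // dvdn_addr ?dvdn_mull //.
by case: r rn => [|r] rn; rewrite ?dvdn0 // gtnNdvd.
Qed.

Lemma clock_high (j : bool) r : r < n -> (n <= clock j r) = j.
Proof. by move=> rn; rewrite clock_small //; case: j => /=; lia. Qed.

(** The whiteboards after [x] was lost in a lap of parity [p], when the first [m] nodes have been
    confirmed. The unset bit on the last node before the hole is what will stop [z]. *)
Record trail (p : bool) m s : Prop := Trail {
  trail_ink : forall d, d < beta -> (boards s (pos d)).1 = Some p;
  trail_foul : (boards s b).1 != Some p;
  trail_conf : forall d, d < m -> d < beta -> (boards s (pos d)).2;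
  trail_end : (boards s (pos beta.-1)).2 = false }.

Lemma trail_eq p m s s' : (forall v, boards s' v = boards s v) ->
  trail p m s -> trail p m s'.
Proof. by move=> E [i f co u]; split=> *; rewrite E; auto. Qed.

Lemma pred_hole : pos beta.-1 != b.
Proof. by rewrite before_hole // prednK. Qed.

Lemma trail_hole p m a e s : trail p m s -> trail p m (black_hole b a e s).
Proof.
move=> [i f co u]; split=> [d db||d dm db|].
- by rewrite board_hole ?before_hole ?i.
- exact: mark_hole.
- by rewrite board_hole ?before_hole ?co.
- by rewrite board_hole ?pred_hole.
Qed.

Definition in_state f q : state n := (f, inord q).

(** All counters agree, so the waiting agents know when [x] is due. The exclusive or in
    [scouting_foul] says that the hole never bears the parity that [x] is to write there on its next
    visit. *)
Record scouting (j : bool) r s : Prop := Scouting {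
  scouting_lt : r < n;
  scouting_team : team s (Some (pos r, in_state Scout (clock j r)))
    (Some (home, in_state (Wait false) (clock j r)))
    (Some (home, in_state (Wait true) (clock j r)));
  scouting_ink : forall d, d < r -> d != beta -> (boards s (pos d)).1 = Some j;
  scouting_foul : (boards s b).1 != Some (j (+) (beta < r));
  scouting_end : (boards s (pos beta.-1)).2 = false }.

Record missing (j : bool) r s : Prop := Missing {
  missing_gt : beta < r;
  missing_le : r <= n;
  missing_team : team s None
    (Some (home, in_state (Wait false) (clock j r)))
    (Some (home, in_state (Wait true) (clock j r)));
  missing_trail : trail j 0 s }.

Lemma wait_step s w (j : bool) r i : r < n -> (r == 0 -> #|present s home| = 3) ->
  advance s i (Some (home, in_state (Wait w) (clock j r))) =
  Some (home, in_state (Wait w) (clock j r.+1)).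
Proof.
move=> rn p3; rewrite /advance /decide /= inordK ?clock_lt // dvd_clock // clockS.
by case: eqP p3 => //= _ ->.
Qed.

Lemma scouting_step r0 a e j r s : scouting j r s ->
  let s' := agents_act r0 (black_hole b a e s) in
  if a && (r == beta) then missing j r.+1 s'
  else if r.+1 < n then scouting j r.+1 s' else scouting (~~ j) 0 s'.
Proof.
move=> [rn ts ink foul endp] s'.
have [] := team_step r0 a e ts; rewrite !kill_home /kill /= eq_pos_small //.
set h := black_hole b a e s in s' *; rewrite -/s' => th ts'.
have present3 : r == 0 -> a && (r == beta) = false -> #|present h home| = 3.
  move=> /eqP r0E dead; move: th; rewrite dead => /card_present->.
  by rewrite /at_home r0E /= eqxx.
have hend : (boards h (pos beta.-1)).2 = false by rewrite board_hole ?pred_hole.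
case: ifP => [/andP[aT /eqP rb]|alive].
  (* The hole strikes before [x] can write, so the mark of the current lap is absent there. *)
  subst r; move: th ts'; rewrite aT eqxx /= => th ts'.
  rewrite !wait_step ?(gtn_eqF beta_gt0) // in ts'; split=> //.
  apply: trail_eq (_ : trail j 0 h).
    by move=> v; rewrite (boards_x r0 v th) //; apply: idle_Some.
  apply: trail_hole; split=> // [d db|].
    by rewrite ink // ltn_eqF.
  by move: foul; rewrite ltnn addbF.
rewrite alive /= in th ts'.
have bd v : boards s' v =
    inked (Some (pos r, in_state Scout (clock j r))) v (boards h v).
  by rewrite (boards_x r0 v th) //; apply: idle_Some.
have inkE v w : inked (Some (pos r, in_state Scout (clock j r))) v w =
   if pos r == v then (Some j, w.2) else w.
  by rewrite /inked /update /= inordK ?clock_lt // clock_high.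
rewrite !wait_step // in ts'; try by move/present3; apply.
have advE : advance h x (Some (pos r, in_state Scout (clock j r))) =
    Some (pos r.+1, in_state Scout (clock j r.+1)).
  by rewrite /advance /decide /= inordK ?clock_lt // clockS.
rewrite advE in ts'.
have end' : (boards s' (pos beta.-1)).2 = false.
  by rewrite bd inkE; case: ifP.
have ink' d : d < r.+1 -> d != beta -> (boards s' (pos d)).1 = Some j.
  move=> dr db; have dn : d < n by apply: leq_trans rn.
  rewrite bd inkE eq_pos_small //; case: eqVneq => //= rd.
  rewrite board_hole ?eq_pos_small // ink //.
  by rewrite ltn_neqAle eq_sym rd.
have foul' : (boards s' b).1 != Some (j (+) (beta <= r)).
  rewrite bd inkE eq_pos_small //; have [->|rb] /= := eqVneq r beta.
    by rewrite leqnn; case: (j).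
  have -> : (beta <= r) = (beta < r) by rewrite leq_eqVlt eq_sym (negPf rb).
  exact: mark_hole.
case: ltnP => [r1n|nr]; first by split.
have rE : r.+1 = n by apply/eqP; rewrite eqn_leq rn nr.
split=> //.
- exact: leq_trans rn.
- by move: ts'; rewrite rE pos_n clock_n.
(* As [beta < n], the hole lies behind [x] when the lap ends; the flip of the parity makes up for
   the return to position 0. *)
- by move: foul'; rewrite -ltnS rE beta_lt ltn0 addbT addbF.
Qed.

Lemma missing_step r0 a e j r s : missing j r s -> r < n ->
  missing j r.+1 (agents_act r0 (black_hole b a e s)).
Proof.
move=> [br _ ts tr] rn.
have [th] := team_step r0 a e ts; rewrite !kill_home /= !wait_step //;
  try by rewrite gtn_eqF // (leq_trans beta_gt0) // ltnW.
move=> ts'; split=> //; first exact: leqW.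
apply: trail_eq (trail_hole a e tr) => v.
by rewrite (boards_x r0 v th) //; apply: idle_kill; apply: idle_Some.
Qed.

(** * From the loss of the scout to the patrol *)

Definition gone (p : bool) (o : option ('I_n * state n)) : Prop :=
  o = None \/ o = Some (b, in_state (Check p) 0).

(* m counts the rounds since y began its walk; each of its steps takes three. *)
Inductive probing p m (o : option ('I_n * state n)) s : Prop :=
| Gone of gone p o & trail p beta.-1 s
| Probing e of e < beta & m = 3 * e
  & o = Some (pos e, in_state (Probe p) 0) & trail p e s
| Checking e of e.+1 < beta & m = (3 * e).+1
  & o = Some (pos e.+1, in_state (Check p) 0) & trail p e s
| Confirming e of e.+1 < beta & m = (3 * e).+2
  & o = Some (pos e, in_state (Confirm p) 0) & trail p e s.

Definition searching p m s : Prop := exists2 o,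
  team s None o (Some (home, in_state Delay m)) & probing p m o s.

Definition following p e s : Prop := exists2 o,
  team s None o (Some (pos e, in_state Follow 0)) & gone p o /\ trail p beta.-1 s.

(** How far to the left of [pos beta.-1] the agent [z] is in round [m] of its patrol period. At
    [m = 2 * n - 1] the truncated subtraction gives 0, as it should. *)
Definition offset m := minn (minn m n.-2) ((2 * n).-2 - m).

Definition patrolling p m s : Prop := exists2 o,
  team s None o (Some (pos (beta.-1 + n - offset (m %% (2 * n))),
                       in_state Patrol (m %% (2 * n))))
  & gone p o /\ (boards s b).1 != Some p.

Lemma in_state0 f : in_state f 0 = (f, ord0).
Proof. by congr (_, _); apply: val_inj; rewrite /= inordK. Qed.

Lemma missing_end r0 a e j s : missing j n s ->
  searching j 0 (agents_act r0 (black_hole b a e s)).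
Proof.
move=> [_ _ ts tr].
have [th] := team_step r0 a e ts; rewrite !kill_home /= in th *.
have c3 := card_present th; rewrite /= eqxx in c3.
rewrite /advance /decide /= !c3 /= clock_n !inordK ?clock_lt //.
rewrite dvd_clock ?(ltn_trans beta_gt0) //= => ts'.
exists (Some (home, in_state (Probe j) 0)).
  rewrite !in_state0; congr team: ts'; congr (Some (_, (Probe _, _))).
  (* The counter is [n] after a lap of parity [false] and 0 after one of parity [true], so the test
     [q == 0] yields [j]. *)
  rewrite clock_small ?(ltn_trans beta_gt0) //; case: (j) => /=; first by rewrite mul0n.
  by rewrite mul1n addn0 gtn_eqF // (ltn_trans beta_gt0).
apply: (@Probing _ _ _ _ 0) => //.
apply: trail_eq (trail_hole a e tr) => v.
by rewrite (boards_x r0 v th) //; apply: idle_Some.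
Qed.

Lemma dest_Right d : dest Right (pos d) = pos d.+1.
Proof. by []. Qed.

Lemma dest_Left d : dest Left (pos d.+1) = pos d.
Proof. exact: ordSK. Qed.

Lemma gone_idle p o : gone p o -> idle o.
Proof. by case=> -> //; apply: idle_Some. Qed.

Lemma gone_kill p a o : gone p o -> gone p (kill a o).
Proof. by rewrite /gone; case=> -> /=; [left|case: ifP => _; [left|right]]. Qed.

(** The mark awaited by [y] never appears on the hole, so [y] stays there until it is destroyed and
    confirms nothing more. *)
Lemma gone_step p s i o :
  (boards s b).1 != Some p -> gone p o -> gone p (advance s i o).
Proof.
move=> /negPf nb [] ->; [by left|right].
by rewrite /advance /decide /= nb -in_state0.
Qed.

Lemma kill_before a d q : d < beta -> kill a (Some (pos d, q)) = Some (pos d, q).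
Proof. by move=> db; rewrite /kill (negPf (before_hole db)) andbF. Qed.

Lemma delay_step s i m : m < 3 * n ->
  advance s i (Some (home, in_state Delay m)) = Some (home, in_state Delay m.+1).
Proof. by move=> mn; rewrite /advance /decide /= inordK ?ltn_eqF // ltnS ltnW. Qed.

Lemma searching_step r0 a e p m s : searching p m s -> m < 3 * n ->
  searching p m.+1 (agents_act r0 (black_hole b a e s)).
Proof.
move=> [o ts pr] mn.
have [th] := team_step r0 a e ts; rewrite kill_home /= delay_step //.
set h := black_hole b a e s in th *; set s' := agents_act _ _; rewrite -/h => ts'.
exists (advance h y (kill a o)) => //.
have trh k : trail p k s -> trail p k h by apply: trail_hole.
have bd v : boards s' v = inked (kill a o) v (boards h v).
  by rewrite (boards_y r0 v th) //; apply: idle_kill; apply: idle_Some.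
have same k : idle (kill a o) -> trail p k s -> trail p k s'.
  move=> io tr; apply: trail_eq (trh _ tr) => v; rewrite bd /inked.
  by case: (kill a o) io => // -[u q] io; case: ifP => // _; apply: (io (u, q)).
case: pr => [go tr|l lb mE oE tr|l lb mE oE tr|l lb mE oE tr].
- have gk := gone_kill a go; apply: Gone; last by apply: same tr; apply: gone_idle gk.
  by apply: gone_step gk; apply: trail_foul (trh _ tr).
- have tr' : trail p l s'.
    by apply: same tr; rewrite oE; apply: idle_kill; apply: idle_Some.
  have adE : advance h y (kill a o) = Some (pos l.+1, in_state (Check p) 0).
    by rewrite oE kill_before // /advance /decide /= -in_state0.
  (* If the node just entered is the hole, [y] is gone and exactly the nodes before [pos beta.-1]
     are known to be confirmed. *)
  have [lb1|bl] := ltnP l.+1 beta.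
    by apply: (@Checking _ _ _ _ l) => //; rewrite mE.
  have lE : l.+1 = beta by apply/eqP; rewrite eqn_leq lb bl.
  by apply: Gone; [right; rewrite adE lE|rewrite -lE].
- apply: (@Confirming _ _ _ _ l) => //; first by rewrite mE.
    rewrite oE kill_before // /advance /decide (trail_ink (trh _ tr)) //.
    by rewrite /= eqxx /= [ord_pred _]dest_Left -in_state0.
  by apply: same tr; rewrite oE; apply: idle_kill; apply: idle_Some.
- apply: (@Probing _ _ _ _ l.+1) => //; first by rewrite mE; lia.
    by rewrite oE kill_before ?(ltn_trans _ lb) // /advance /decide /= -in_state0.
  have lb' : l < beta by apply: ltnW.
  have [ink foul conf end_] := trh _ tr.
  have bd' v : boards s' v = if pos l == v then ((boards h v).1, true) else boards h v.
    by rewrite bd oE kill_before.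
  split=> [d db||d dl db|]; rewrite bd'.
  + by case: ifP => _; apply: ink.
  + by case: ifP => _.
  + have dn := ltn_trans db beta_lt.
    rewrite eq_pos_small ?(ltn_trans lb') //; case: eqVneq => // ld; apply: conf => //.
    by rewrite ltn_neqAle eq_sym ld.
  + have bn : beta.-1 < n by rewrite prednK // ltnW.
    by rewrite eq_pos_small ?(ltn_trans lb') // ltn_eqF // -ltnS prednK.
Qed.

(** Three rounds per step and fewer than [n] steps: after [3 * n] rounds only the case [Gone]
    remains. *)
Lemma searching_end r0 a e p s : searching p (3 * n) s ->
  following p 0 (agents_act r0 (black_hole b a e s)).
Proof.
move=> [o ts [go tr|l lb mE|l lb mE|l lb mE]]; try by lia.
have gk := gone_kill a go; have trh := trail_hole a e tr.
have [th ts'] := team_step r0 a e ts.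
exists (advance (black_hole b a e s) y (kill a o)).
  move: ts'; rewrite kill_home /=; congr team.
  by rewrite /advance /decide /= inordK ?ltnSn // eqxx -in_state0.
split; first by apply: gone_step gk; apply: trail_foul trh.
apply: trail_eq trh => v; rewrite (boards_y r0 v th) //; last first.
  by apply: idle_kill; apply: idle_Some.
by case: gk => ->; rewrite /inked //; case: ifP.
Qed.

Lemma following_step r0 a e p l s : following p l s -> l < beta ->
  let s' := agents_act r0 (black_hole b a e s) in
  if l.+1 < beta then following p l.+1 s' else patrolling p 0 s'.
Proof.
move=> [o ts [go tr]] lb s'.
have gk := gone_kill a go; have trh := trail_hole a e tr.
have [th] := team_step r0 a e ts; rewrite kill_before // [kill _ None]/= -/s' => ts'.
have tr' : trail p beta.-1 s'.
  apply: trail_eq trh => v; rewrite (boards_y r0 v th) //; last first.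
    by apply: idle_kill; apply: idle_Some.
  by case: gk => ->; rewrite /inked //; case: ifP.
have gk' := gone_step y (trail_foul trh) gk.
case: ifP => lb1.
  exists (advance (black_hole b a e s) y (kill a o)) => //.
  move: ts'; congr team; rewrite /advance /decide.
  rewrite [in_state _ _]in_state0 /= (trail_conf trh) //=.
  by rewrite -ltnS prednK.
have lE : l = beta.-1 by lia.
exists (advance (black_hole b a e s) y (kill a o)); last by split; rewrite ?(trail_foul tr').
move: ts'; congr team; rewrite /advance /decide.
rewrite [in_state _ _]in_state0 lE /= (trail_end trh) /=.
rewrite mod0n in_state0 /offset !min0n subn0; congr (Some (_, _)); apply/eqP.
by rewrite eq_pos modnDr.
Qed.

Lemma patrolling_step r0 a e p m s : patrolling p m s ->
  patrolling p m.+1 (agents_act r0 (black_hole b a e s)).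
Proof.
move=> [o ts [go foul]].
have gk := gone_kill a go; have foulh := mark_hole a e foul.
have n_gt1 : 1 < n by apply: leq_ltn_trans beta_lt.
set q := m %% (2 * n) in ts *.
have q_lt : q < 2 * n by rewrite ltn_mod; lia.
have off_le : offset q <= n.-2 by rewrite /offset; lia.
(* The index lies strictly between [beta] and [beta + n], so [z] is never on the hole. The summand
   [n] keeps the subtraction from being truncated. *)
have nb : pos (beta.-1 + n - offset q) != b.
  set k := _ - _; have [bk kb] : beta < k /\ k - beta < n by rewrite /k; lia.
  rewrite -(subnKC (ltnW bk)) eq_pos -[X in _ == X %[mod _]]addn0.
  rewrite eqn_modDl mod0n modn_small //.
  by rewrite subn_eq0 -ltnNge.
have [th ts'] := team_step r0 a e ts; rewrite [kill _ None]/= in th ts'.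
exists (advance (black_hole b a e s) y (kill a o)); last first.
  split; first by apply: gone_step gk.
  rewrite (boards_y r0 b th) //; last by apply: idle_kill; apply: idle_Some.
  by case: gk => ->; rewrite /inked //; case: ifP.
move: ts'; rewrite {2}/kill (negPf nb) andbF; congr team.
rewrite /advance /decide /=.
have -> : m.+1 %% (2 * n) = q.+1 %% (2 * n) by rewrite -addn1 -modnDml addn1.
rewrite inordK; last by lia.
congr (Some (_, _)).
have [qn|nq] := ltnP q.+2 n.
  rewrite modn_small; last by lia.
  rewrite (_ : _ - offset q = (beta.-1 + n - offset q.+1).+1); last by rewrite /offset; lia.
  exact: dest_Left.
case: ifP => mid.
  rewrite modn_small; last by lia.
  rewrite dest_Right; congr pos; rewrite /offset; lia.
(* The rounds of rest at either end of the patrol, including the wrap to a new period. *)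
rewrite (_ : offset (_ %% _) = offset q) //.
have [q1|q1] := ltnP q.+1 (2 * n); first by rewrite modn_small // /offset; lia.
have -> : q.+1 = 2 * n by lia.
by rewrite modnn /offset; lia.
Qed.

(** * Perpetual exploration *)

Variable e : nat -> config A n.
Hypothesis e_step : forall t, exists r a er,
  e t.+1 = agents_act r (black_hole b a er (e t)).

Lemma patrolling_visits p t0 v T : patrolling p 0 (e t0) -> v != b ->
  exists2 t, T <= t & visited (e t) v.
Proof.
move=> pt; have [d dn ->] := pos_surj v; rewrite eq_pos_small // => db.
(* The number of steps left from [pos beta.-1] to [pos d]; nodes beyond the hole are reached through
   home. On its way out [z] is there in round [o] of each period. *)
pose o := if d < beta then beta.-1 - d else beta.-1 + n - d.
have o_le : o <= n.-2 by rewrite /o; case: ifP; lia.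
exists (t0 + (T * (2 * n) + o)).
  apply: leq_trans (leq_addl _ _); apply: leq_trans (leq_addr _ _).
  by apply: leq_pmulr; lia.
have pa m : patrolling p m (e (t0 + m)).
  elim: m => [|m IHm]; first by rewrite addn0.
  by rewrite addnS; have [r [a [er ->]]] := e_step (t0 + m); apply: patrolling_step.
have [oy tm _] := pa (T * (2 * n) + o).
exists z; rewrite /is_at tm ![z == _]eq_sym (negPf xz) (negPf yz) eqxx /=.
rewrite modnMDl modn_small; last by lia.
rewrite (_ : offset o = o); last by rewrite /offset; lia.
rewrite eq_pos; apply/eqP.
rewrite (_ : _ - o = (if d < beta then n else 0) + d); last by rewrite /o; case: ifP; lia.
by case: ifP => _; rewrite ?modnDl.
Qed.

(** No choice of the adversary delays [z]: each stage lasts a fixed number of rounds. *)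
Lemma missing_patrolling j r t : missing j r (e t) -> exists t', patrolling j 0 (e t').
Proof.
move=> ms.
have [t1 ms1] : exists t1, missing j n (e t1).
  have [k rE] : exists k, n = k + r.
    by exists (n - r); rewrite subnK //; case: ms.
  elim: k r t rE ms => [|k IHk] r t rE ms.
    by exists t; rewrite (esym rE : r = n) in ms.
  apply: (IHk r.+1 t.+1); first by rewrite rE addSnnS.
  by have [r0 [a [er ->]]] := e_step t; apply: missing_step => //; lia.
have [r1 [a1 [er1 E1]]] := e_step t1.
have := missing_end r1 a1 er1 ms1; rewrite -E1 => se.
have {}se m : m <= 3 * n -> searching j m (e (t1.+1 + m)).
  elim: m => [|m IHm] mn; first by rewrite addn0.
  rewrite addnS; have [r0 [a [er ->]]] := e_step (t1.+1 + m).
  by apply: searching_step => //; apply: IHm; apply: ltnW.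
have {}se := se _ (leqnn _); set t2 := t1.+1 + _ in se.
have [r2 [a2 [er2 E2]]] := e_step t2.
have := searching_end r2 a2 er2 se; rewrite -E2 => fo.
have {}fo l : l < beta -> following j l (e (t2.+1 + l)).
  elim: l => [|l IHl] lb; first by rewrite addn0.
  rewrite addnS; have [r0 [a [er ->]]] := e_step (t2.+1 + l).
  by have := following_step r0 a er (IHl (ltnW lb)) (ltnW lb); rewrite lb.
have lb : beta.-1 < beta by rewrite prednK.
have [r3 [a3 [er3 E3]]] := e_step (t2.+1 + beta.-1).
exists (t2.+1 + beta.-1).+1; rewrite E3.
by have := following_step r3 a3 er3 (fo _ lb) lb; rewrite prednK // ltnn.
Qed.

(** Either [x] is lost at some time and the patrol of [z] explores, or [x] survives and its endless
    laps do. *)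
Lemma scouting_explores : scouting false 0 (e 0) -> perpetual_exploration b e.
Proof.
move=> sc0 v vb T.
have dichotomy t : (exists t' j r, missing j r (e t')) \/
    exists j, scouting j (t %% n) (e t).
  elim: t => [|t [IHt|[j sc]]]; [by right; exists false; rewrite mod0n|by left|].
  have [r0 [a [er E]]] := e_step t.
  have rn := scouting_lt sc.
  have := scouting_step r0 a er sc; rewrite -E => /=; case: ifP => _ st.
    by left; do 3!eexists; exact: st.
  have -> : t.+1 %% n = (t %% n).+1 %% n by rewrite -addn1 -(modnDml t) addn1.
  right; move: st; case: ltnP => [lt|ge] st.
    by exists j; rewrite modn_small.
  exists (~~ j); suff ->: (t %% n).+1 = n by rewrite modnn.
  by apply/eqP; rewrite eqn_leq rn.
have [d dn vE] := pos_surj v.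
have [[t' [j [r /missing_patrolling[t pt]]]]|[j sc]] := dichotomy (T * n + d).
  exact: patrolling_visits pt vb.
exists (T * n + d).
  by rewrite (leq_trans _ (leq_addr _ _)) ?leq_pmulr // (ltn_trans beta_gt0).
exists x; rewrite /is_at (scouting_team sc) eqxx /= modnMDl modn_small //.
by rewrite vE eqxx.
Qed.

Lemma start_scouting r a er : let D := [set x; y; z] in
  initial_phase x D = Scout -> initial_phase y D = Wait false ->
  initial_phase z D = Wait true ->
  scouting false 0 (agents_act r (black_hole b a er (start A D home))).
Proof.
move=> D xS yS zS.
have ts : team (start A D home) (Some (home, in_state Start 0))
    (Some (home, in_state Start 0)) (Some (home, in_state Start 0)).
  move=> i; rewrite /= !inE in_state0.
  by case: eqP => // _; case: eqP => // _; case: eqP.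
have [th] := team_step r a er ts; rewrite !kill_home.
set h := black_hole _ _ _ _ in th *; set s' := agents_act r h; rewrite -/h.
have pD : present h home = D.
  apply/setP => i; rewrite !inE /is_at th !kill_home.
  by do 3![case: eqP => _; rewrite ?eqxx //].
rewrite /advance /decide [in_state _ _]in_state0 /= pD xS yS zS => ts'.
have bh v : boards h v = (None, false).
  by rewrite /h /black_hole; case: (a) => //=; case: ifP.
have bd v : boards s' v = (None, false).
  rewrite /s' (boards_x r v th) ?kill_home; try exact: idle_Some.
  by rewrite /inked bh; case: ifP.
have c0 : clock false 0 = 0 by rewrite /clock mod0n.
split=> //; rewrite ?bd //; first exact: ltn_trans beta_lt.
by rewrite c0 !in_state0.
Qed.

End Algorithm.

Lemma cautious_team_solves c (ord : access_order 3 c) :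
  solves_PerpExploration_BBH ord (cautious_team c).
Proof.
move=> n home b D adv bh cardD.
have : size (enum D) = 3 by rewrite -cardE.
case ED: (enum D) => [|x [|y [|z []]]] // _.
have := enum_uniq (mem D); rewrite ED /= !inE negb_or andbT => /andP[/andP[xy xz] yz].
have DE : D = [set x; y; z].
  by apply/setP => i; rewrite -mem_enum ED !inE orbA.
have [beta beta_lt bE] := pos_surj home b.
have beta_gt0 : 0 < beta by case: beta bE {beta_lt} bh => // ->; rewrite eqxx.
rewrite bE => v vb T.
(* The first round is spent at home to assign the roles, hence the shift by one. *)
pose e t := run ord adv (pos home beta) (start (cautious_team c) D home) t.+1.
have [t Tt vt] : exists2 t, T <= t & visited (e t) v; last first.
  by exists t.+1 => //; apply: ltnW.
apply: (@scouting_explores c n home x y z beta) => //.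
  by move=> t; exists (ord t.+1), (active adv t.+1), (erase adv t.+1).
rewrite /e /= DE; apply: start_scouting => //; rewrite -DE /initial_phase ED /= ?eqxx //.
  by rewrite (negPf xy).
by rewrite (negPf xz) (negPf yz).
Qed.

Theorem theorem10 (c : nat) :
  (exists A : algorithm 3 c,
     forall ord : access_order 3 c, solves_PerpExploration_BBH ord A)
  /\
  (forall k : nat, k < 3 ->
     forall (ord : access_order k c) (A : algorithm k c),
       ~ solves_PerpExploration_BBH ord A).
Proof.
split; first by exists (cautious_team c) => ord; apply: cautious_team_solves.
by move=> k k_lt3 ord A; apply: two_agents_fail.
Qed.
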